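(* Let $n\ge1$, $m\ge2$, $V=\mathbb{R}^{2n}$ with its standard symplectic form $\omega$, and let $G_1=\mathrm{CSp}(2n,\mathbb{R})=\mathrm{Sp}(2n,\mathbb{R})\times\mathbb{R}_+$ act diagonally on $V^{\times m}$, with $\mathbb{R}_+$ acting by scalings of $V$. Then the functions $I_{ij}=\dfrac{a_{ij}}{a_{12}}$, $1\le i<j\le m$, generate the field of $G_1$-invariant real rational functions on $V^{\times m}$, and this field has transcendence degree $d(m,n)-1$ over $\mathbb{R}$, where $$d(m,n)=\begin{cases}2nm-n(2n+1)&\text{for } m\ge 2n,\\ \binom m2&\text{for } m\le 2n.\end{cases}$$
   Context: $V=\mathbb{R}^{2n}$ has coordinates $(x^1,\dots,x^n,y^1,\dots,y^n)$ and $\omega=dx^1\wedge dy^1+\dots+dx^n\wedge dy^n$. For a point $(A_1,\dots,A_m)\in V^{\times m}$, $a_{ij}=\omega(A_i,A_j)$. *)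

(* Defs.v *)
From HB Require Import structures.
From mathcomp Require Import all_boot all_order all_algebra.
From mathcomp Require Import fraction generic_quotient mpoly.
From mathcomp Require Import classical_sets reals.

Set Implicit Arguments.
Unset Strict Implicit.
Unset Printing Implicit Defensive.

Import GRing.Theory Num.Theory.
Local Open Scope classical_set_scope.
Local Open Scope ring_scope.

(* Below, a field extension of k is a field L together with a ring morphism
   iota : k -> L, and its subsets are classical sets. *)

Definition subfield_closed (L : fieldType) (K : set L) : Prop :=
  GRing.divring_closed [pred x | x \in K].

Definition adjoin (k L : fieldType) (iota : {rmorphism k -> L}) (S : set L) :
  set L := smallest (@subfield_closed L) (range iota `|` S).

Definition alg_independent (k L : fieldType) (iota : {rmorphism k -> L})
  (d : nat) (s : 'I_d -> L) : Prop :=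
  forall p : {mpoly k[d]}, mmap iota s p = 0 -> p = 0.

Definition algebraic_over (L : fieldType) (K : set L) (x : L) : Prop :=
  exists p : {poly L}, [/\ p != 0, forall i, K p`_i & root p x].

Definition transcendence_basis (k L : fieldType) (iota : {rmorphism k -> L})
  (K : set L) (d : nat) (s : 'I_d -> L) : Prop :=
  [/\ forall i, K (s i), alg_independent iota s
    & forall x, K x -> algebraic_over (adjoin iota (range s)) x].

Definition has_trdeg (k L : fieldType) (iota : {rmorphism k -> L})
  (K : set L) (d : nat) : Prop :=
  exists s : 'I_d -> L, transcendence_basis iota K s.

(* V = R^{2n} is 'cV_(n + n), with x^k in row lshift n k and y^k in row
   rshift n k. The ring is arbitrary because omega is also applied to vectors
   of polynomials. *)
Definition omega (S : comNzRingType) (n : nat) (u v : 'cV[S]_(n + n)) : S :=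
  \sum_(k < n) (u (lshift n k) 0 * v (rshift n k) 0
                - u (rshift n k) 0 * v (lshift n k) 0).

Definition Sp (R : realType) (n : nat) : set 'M[R]_(n + n) :=
  [set g | g \in unitmx /\
           forall u v : 'cV[R]_(n + n), omega (g *m u) (g *m v) = omega u v].

(* Sp x R_+ acts on V through its image in GL(V); the product map is injective
   because -1 is not in R_+. *)
Definition CSp (R : realType) (n : nat) : set 'M[R]_(n + n) :=
  [set h | exists g t, [/\ Sp g, 0 < t & h = t *: g]].

(* A point (A_1, ..., A_m) of V^m is the matrix with columns A_1, ..., A_m;
   its entry (k, i) is the coordinate of index mxvec_index k i. *)
Notation polyV R n m := {mpoly R[(n + n) * m]}.
Notation ratV R n m := {fraction {mpoly R[(n + n) * m]}}.

Definition generic_point (R : realType) (n m : nat) :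
  'M[polyV R n m]_(n + n, m) :=
  \matrix_(k < n + n, i < m) 'X_(mxvec_index k i).

Definition constV (R : realType) (n m : nat) : {rmorphism R -> ratV R n m} :=
  (@tofrac (polyV R n m)) \o (@mpolyC ((n + n) * m) R).

(* The coordinates of g A = (g A_1, ..., g A_m), as polynomials in those of
   A. *)
Definition act_coord (R : realType) (n m : nat) (g : 'M[R]_(n + n))
  (k : 'I_((n + n) * m)) : polyV R n m :=
  mxvec (map_mx (@mpolyC _ R) g *m generic_point R n m) 0 k.

(* p o g, for the diagonal action of g on V^m. *)
Definition poly_pullback (R : realType) (n m : nat) (g : 'M[R]_(n + n))
  (p : polyV R n m) : polyV R n m :=
  p \mPo [tuple act_coord g k | k < (n + n) * m].

(* f o g, computed on the representative of f chosen by repr; for invertible g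
   it does not depend on that choice, see rat_pullback_div. *)
Definition rat_pullback (R : realType) (n m : nat) (g : 'M[R]_(n + n))
  (f : ratV R n m) : ratV R n m :=
  tofrac (poly_pullback g \n_(repr f)) / tofrac (poly_pullback g \d_(repr f)).

Lemma comp_mpolyA (R : comNzRingType) (n k l : nat)
  (lp : n.-tuple {mpoly R[k]}) (lq : k.-tuple {mpoly R[l]}) (p : {mpoly R[n]}) :
  (p \mPo lp) \mPo lq = p \mPo [tuple tnth lp i \mPo lq | i < n].
Proof.
rewrite [p \mPo lp]comp_mpolyEX [RHS]comp_mpolyEX (raddf_sum (comp_mpoly lq)) /=.
apply: eq_bigr => a _.
rewrite !comp_mpolyZ; congr (_ *: _); rewrite !comp_mpolyX rmorph_prod /=.
by apply: eq_bigr => i _; rewrite rmorphXn /= tnth_mktuple.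
Qed.

Lemma act_coordE (R : realType) (n m : nat) (g : 'M[R]_(n + n)) k i :
  act_coord g (mxvec_index k i) =
  \sum_l (g k l)%:MP * 'X_(mxvec_index l i) :> polyV R n m.
Proof.
rewrite /act_coord mxvecE mxE.
by apply: eq_bigr => l _; rewrite !mxE.
Qed.

Lemma poly_pullback_comp (R : realType) (n m : nat) (g h : 'M[R]_(n + n))
  (p : polyV R n m) :
  poly_pullback g (poly_pullback h p) = poly_pullback (h *m g) p.
Proof.
rewrite /poly_pullback [LHS]comp_mpolyA; congr (_ \mPo _).
apply: eq_from_tnth => k; rewrite [LHS]tnth_mktuple [RHS]tnth_mktuple.
rewrite [X in X \mPo _]tnth_mktuple.
case/mxvec_indexP: k => k i; rewrite [RHS]act_coordE [X in X \mPo _]act_coordE.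
rewrite (raddf_sum (comp_mpoly _)) /=.
under eq_bigr => l _.
  rewrite rmorphM /= comp_mpolyC comp_mpolyXU -tnth_nth tnth_mktuple act_coordE.
  rewrite mulr_sumr.
  over.
rewrite exchange_big /=; apply: eq_bigr => l _.
rewrite mxE raddf_sum /= mulr_suml; apply: eq_bigr => l' _.
by rewrite mulrA mpolyCM.
Qed.

Lemma poly_pullback1 (R : realType) (n m : nat) (p : polyV R n m) :
  poly_pullback 1%:M p = p.
Proof.
rewrite /poly_pullback -[RHS]comp_mpoly_id; congr (_ \mPo _).
apply: eq_from_tnth => k; rewrite [LHS]tnth_mktuple [RHS]tnth_mktuple.
case/mxvec_indexP: k => k i; rewrite act_coordE (bigD1 k) //= big1 => [|l lk].
  by rewrite mxE eqxx mpolyC1 mul1r addr0.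
by rewrite mxE eq_sym (negPf lk) mpolyC0 mul0r.
Qed.

Lemma poly_pullback_eq0 (R : realType) (n m : nat) (g : 'M[R]_(n + n))
  (p : polyV R n m) : g \in unitmx -> (poly_pullback g p == 0) = (p == 0).
Proof.
move=> gU; apply/eqP/eqP => [p0|->]; last exact: comp_mpoly0.
rewrite -[p]poly_pullback1 -(mulmxV gU) -poly_pullback_comp.
by rewrite p0 /poly_pullback comp_mpoly0.
Qed.

Lemma tofrac_repr (A : idomainType) (f : {fraction A}) :
  tofrac \n_(repr f) / tofrac \d_(repr f) = f.
Proof.
rewrite -[RHS]reprK; set r := repr f; unlock tofrac.
rewrite -[X in _ * X]FracField.pi_inv -[LHS]FracField.pi_mul /FracField.mulf.
rewrite /FracField.invf !numden_Ratio ?oner_neq0 ?denom_ratioP // mulr1 mul1r.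
by rewrite Ratio_numden.
Qed.

Lemma rat_pullback_div (R : realType) (n m : nat) (g : 'M[R]_(n + n))
  (p q : polyV R n m) : g \in unitmx -> q != 0 ->
  rat_pullback g (tofrac p / tofrac q) =
  tofrac (poly_pullback g p) / tofrac (poly_pullback g q).
Proof.
move=> gU q0; rewrite /rat_pullback; have := tofrac_repr (tofrac p / tofrac q).
set r := repr _; have d0 : \d_r != 0 by exact: denom_ratioP.
move/eqP; rewrite eqr_div ?tofrac_eq0 // -!tofracM tofrac_eq => /eqP E.
apply/eqP; rewrite eqr_div ?tofrac_eq0 ?poly_pullback_eq0 // -!tofracM tofrac_eq.
rewrite /poly_pullback -[X in X == _](rmorphM (comp_mpoly _)) E.
by rewrite (rmorphM (comp_mpoly _)).
Qed.

Definition invariant_field (R : realType) (n m : nat)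
  (G : set 'M[R]_(n + n)) : set (ratV R n m) :=
  [set f | forall g, G g -> rat_pullback g f = f].

Definition omega_ij (R : realType) (n m : nat) (i j : 'I_m) : ratV R n m :=
  tofrac (omega (col i (generic_point R n m)) (col j (generic_point R n m))).

(* At m = 2n the two expressions agree. *)
Definition dmn (m n : nat) : nat :=
  if (2 * n <= m)%N then (2 * n * m - n * (2 * n + 1))%N else 'C(m, 2).

(* Main.v *)
Require Import Defs.
From HB Require Import structures.
From mathcomp Require Import all_boot all_order all_algebra.
From mathcomp Require Import fraction generic_quotient mpoly.
From mathcomp Require Import classical_sets reals.
From mathcomp Require Import boolp ring zify.

Set Implicit Arguments.
Unset Strict Implicit.
Unset Printing Implicit Defensive.

Import Order.TTheory GRing.Theory Num.Theory.
Local Open Scope classical_set_scope.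
Local Open Scope ring_scope.

(* Symplectic Gram-Schmidt, applied to the Gram matrix (a_ij / a_12), produces
   a normal form C of the generic point X whose entries lie in the field
   generated by the entries of index min(i, j) < 2n (counting from 0), and a
   matrix g over R(V^m), conformally symplectic with multiplier 1 / a_12, such
   that g X = C. If m < 2n, X is first completed by constant vectors.

   An invariant p / q takes the same value at x and at g(x) x for every real
   point x at which g is regular, so p / q = p(C) / q(C). Two points need care.
   Multipliers may be negative: the identity expressing the invariance under
   (x, y) |-> (x, s y) is polynomial in s, hence extends from s > 0 to all s.
   And q(C) must not vanish: g is replaced with g(x0)^-1 g for a real point x0
   at which q does not vanish, so that C(x0) = x0.

   Hence the a_ij / a_12 with i < j, i < 2n and (i, j) <> (0, 1) already generate
   the field of invariants. They are independent because the same Gram-Schmidt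
   process builds a point at which they take indeterminate values. *)

(** * Regular values of rational functions *)

(** There are fewer roots than [size p], so one of the values 1, ..., [size p] is not a root. Its
    positivity matters where it serves as a multiplier, in [invariant_dilation]. *)
Lemma poly_nat_nonroot (R : numFieldType) (p : {poly R}) :
  p != 0 -> exists k : nat, p.[k.+1%:R] != 0.
Proof.
move=> p0; pose s := [seq k.+1%:R : R | k <- iota 0 (size p)].
have us : uniq s.
  by rewrite map_inj_uniq ?iota_uniq // => i j /eqP; rewrite eqr_nat => /eqP [].
have /allPn[_ /mapP[k _ ->] kr] : ~~ all (root p) s.
  apply/negP => sr; have := max_poly_roots p0 sr us.
  by rewrite size_map size_iota ltnn.
by exists k.
Qed.

(** Induction on the number of variables: [muni] turns p into a polynomial in the last variable. A
    point where its leading coefficient does not vanish leaves a nonzero univariate polynomial. *)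
Lemma mpoly_nonroot (R : numFieldType) (N : nat) (p : {mpoly R[N]}) :
  p != 0 -> exists x : 'I_N -> R, p.@[x] != 0.
Proof.
elim: N p => [|N IH] p p0.
  exists (fun=> 0); have [c pE] : exists c, p = c%:MP.
    exists p@_0; apply/mpolyP => m; have -> : m = 0%MM by apply/mnmP => -[].
    by rewrite mcoeffC eqxx mulr1.
  by move: p0; rewrite pE mevalC mpolyC_eq0.
have mp0 : muni p != 0.
  have [m0 pm0] : exists m, m \in msupp p.
    case E: (msupp p) => [|m s]; last by exists m; rewrite mem_head.
    by move/eqP: E p0; rewrite msupp_eq0 => ->.
  (* The monomial [m0] splits into a power of the last variable and a monomial in the others; the
     matching coefficient of [muni p] is that of [m0] in p. *)
  have : ((muni p)`_(m0 ord_max))@_[multinom m0 (widen_ord (leqnSn N) i) | i < N]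
       != 0.
    rewrite muniE coef_sum raddf_sum /= (bigD1_seq m0) ?msupp_uniq //=.
    rewrite [X in _ + X]big1 ?addr0 => [|m mm0].
      by rewrite coefZ coefXn eqxx mulr1 mcoeffZ mcoeffX eqxx mulr1 -mcoeff_msupp.
    rewrite coefZ coefXn; case: eqP => [e|_]; last by rewrite mulr0 mcoeff0.
    rewrite mulr1 mcoeffZ mcoeffX; case: eqP => [e'|_]; last by rewrite mulr0.
    case/eqP: mm0; apply/mnmP => i.
    have [[j ->]|->] : (exists j : 'I_N, i = widen_ord (leqnSn N) j) \/ i = ord_max.
    - case: (ltnP i N) => h; first by left; exists (Ordinal h); apply: val_inj.
      by right; apply: val_inj; apply/eqP; rewrite eqn_leq h -ltnS ltn_ord.
    - by have := congr1 (fun f : 'X_{1..N} => f j) e'; rewrite !mnmE.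
    - by rewrite e.
  by apply: contraNneq => ->; rewrite coef0 mcoeff0.
have l0 : lead_coef (muni p) != 0 by rewrite lead_coef_eq0.
have [y yP] := IH _ l0.
have q0 : map_poly (meval y) (muni p) != 0.
  apply: contraNneq yP => /polyP /(_ (size (muni p)).-1).
  by rewrite coef_map coef0 /= => ->.
have [k kP] := poly_nat_nonroot q0.
exists (fun i => if insub (i : nat) is Some j then y j else k.+1%:R).
apply: contraNneq kP => {q0 yP l0 mp0 p0} <-.
rewrite mevalE muniE raddf_sum /= horner_sum; apply/eqP/eq_bigr => m _.
rewrite big_ord_recr /= insubF ?ltnn // map_polyZ /= map_polyXn hornerZ hornerXn.
rewrite mevalZ mevalX mulrA; congr (_ * _ * _); apply: eq_bigr => i _.
by rewrite mnmE insubT //= => h; congr (y _ ^+ _); exact: val_inj.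
Qed.

Section RegularValue.
Variables (k F : fieldType) (iota : {rmorphism k -> F}) (N : nat).
Variable x : 'I_N -> F.
Local Notation ratN := {fraction {mpoly k[N]}}.
Local Notation ev := (mmap iota x).

(** Regularity of f at x, with value v. The point has coordinates in an extension F of k, which
    covers real points as well as points with indeterminate coordinates. A relation avoids choosing
    a representative of f. *)
Definition regval (f : ratN) (v : F) : Prop :=
  exists a b : {mpoly k[N]},
    [/\ f = tofrac a / tofrac b, ev b != 0 & v = ev a / ev b].

Lemma mmap_neq0 (b : {mpoly k[N]}) : ev b != 0 -> b != 0.
Proof. by apply: contraNneq => ->; rewrite rmorph0. Qed.

Lemma regval_tofrac (a : {mpoly k[N]}) : regval (tofrac a) (ev a).
Proof. by exists a, 1; rewrite !rmorph1 oner_eq0 !divr1. Qed.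

Lemma regval_uniq f v w : regval f v -> regval f w -> v = w.
Proof.
move=> [a [b [-> b0 ->]]] [c [d [/eqP e d0 ->]]].
move: e; rewrite eqr_div ?tofrac_eq0 ?mmap_neq0 // -!tofracM tofrac_eq => /eqP e.
by apply/eqP; rewrite eqr_div // -!rmorphM e.
Qed.

Lemma regval_const c : regval (tofrac c%:MP) (iota c).
Proof. by rewrite -(mmapC x iota); apply: regval_tofrac. Qed.

Lemma regval0 : regval 0 0.
Proof. by rewrite -tofrac0 -[X in regval _ X](rmorph0 ev); apply: regval_tofrac. Qed.

Lemma regval1 : regval 1 1.
Proof. by rewrite -tofrac1 -[X in regval _ X](rmorph1 ev); apply: regval_tofrac. Qed.

Lemma regvalD f g v w : regval f v -> regval g w -> regval (f + g) (v + w).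
Proof.
move=> [a [b [-> b0 ->]]] [c [d [-> d0 ->]]]; exists (a * d + c * b), (b * d).
rewrite !addf_div ?tofrac_eq0 ?mmap_neq0 //.
by rewrite !tofracD !tofracM !rmorphD !rmorphM /= mulf_neq0.
Qed.

Lemma regvalM f g v w : regval f v -> regval g w -> regval (f * g) (v * w).
Proof.
move=> [a [b [-> b0 ->]]] [c [d [-> d0 ->]]]; exists (a * c), (b * d).
by rewrite !mulf_div !tofracM !rmorphM /= mulf_neq0.
Qed.

Lemma regvalN f v : regval f v -> regval (- f) (- v).
Proof.
by move=> [a [b [-> b0 ->]]]; exists (- a), b; rewrite tofracN !mulNr rmorphN mulNr.
Qed.

Lemma regvalB f g v w : regval f v -> regval g w -> regval (f - g) (v - w).
Proof. by move=> rf rg; apply/regvalD/regvalN. Qed.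

Lemma regvalV f v : regval f v -> v != 0 -> regval f^-1 v^-1.
Proof.
move=> [a [b [-> b0 ->]]]; rewrite mulf_eq0 invr_eq0 (negPf b0) orbF => a0.
by exists b, a; rewrite !invf_div.
Qed.

Lemma regval_div f g v w :
  regval f v -> regval g w -> w != 0 -> regval (f / g) (v / w).
Proof. by move=> rf rg w0; apply/regvalM/regvalV. Qed.

(** One nonzero value certifies that a rational function is nonzero. Pivots, determinants and
    denominators are all treated this way. *)
Lemma regval_neq0 f v : regval f v -> v != 0 -> f != 0.
Proof.
move=> rf; apply: contraNneq => f0; apply/eqP/(regval_uniq rf).
by rewrite f0; apply: regval0.
Qed.

Lemma regval_sum (I : Type) (r : seq I) (P : pred I) (f : I -> ratN) (v : I -> F) :
  (forall i, P i -> regval (f i) (v i)) ->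
  regval (\sum_(i <- r | P i) f i) (\sum_(i <- r | P i) v i).
Proof.
by move=> fv; apply: big_ind2 => //; [apply: regval0 | move=> *; apply: regvalD].
Qed.

Lemma regval_prod (I : Type) (r : seq I) (P : pred I) (f : I -> ratN) (v : I -> F) :
  (forall i, P i -> regval (f i) (v i)) ->
  regval (\prod_(i <- r | P i) f i) (\prod_(i <- r | P i) v i).
Proof.
by move=> fv; apply: big_ind2 => //; [apply: regval1 | move=> *; apply: regvalM].
Qed.

Lemma regval_exp f v e : regval f v -> regval (f ^+ e) (v ^+ e).
Proof.
by move=> fv; elim: e => [|e IH]; rewrite ?exprS; [apply: regval1 | apply: regvalM].
Qed.

Lemma regval_mmap (j : {rmorphism k -> ratN}) (M : nat) (f : 'I_M -> ratN)
    (v : 'I_M -> F) (q : {mpoly k[M]}) :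
  (forall c, j c = tofrac c%:MP) -> (forall i, regval (f i) (v i)) ->
  regval (mmap j f q) (mmap iota v q).
Proof.
move=> jE fv; apply: regval_sum => m _; apply: regvalM.
  by rewrite jE; apply: regval_const.
by apply: regval_prod => i _; apply: regval_exp.
Qed.

Lemma regval_mulmx m p r (A : 'M[ratN]_(m, p)) (B : 'M[ratN]_(p, r))
    (A' : 'M[F]_(m, p)) (B' : 'M[F]_(p, r)) :
  (forall i j, regval (A i j) (A' i j)) -> (forall i j, regval (B i j) (B' i j)) ->
  forall i j, regval ((A *m B) i j) ((A' *m B') i j).
Proof. by move=> rA rB i j; rewrite !mxE; apply: regval_sum => l _; apply: regvalM. Qed.

Lemma regval_det m (A : 'M[ratN]_m) (A' : 'M[F]_m) :
  (forall i j, regval (A i j) (A' i j)) -> regval (\det A) (\det A').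
Proof.
move=> rA; apply: regval_sum => s _; apply: regvalM; last exact: regval_prod.
by apply/regval_exp/regvalN/regval1.
Qed.

End RegularValue.

(** The product of p and of the denominators of all the [f i] is a nonzero polynomial, so it does
    not vanish at some point. *)
Lemma regular_point (R : numFieldType) (N : nat) (p : {mpoly R[N]})
    (I : finType) (f : I -> {fraction {mpoly R[N]}}) :
  p != 0 -> exists (x : 'I_N -> R) (v : I -> R),
    p.@[x] != 0 /\ forall i, regval idfun x (f i) (v i).
Proof.
move=> p0.
have d0 i : \d_(repr (f i)) != 0 by exact: denom_ratioP.
have [|x] := @mpoly_nonroot R N (p * \prod_i \d_(repr (f i))).
  by rewrite mulf_neq0 // prodf_seq_neq0; apply/allP => i _; rewrite d0 implybT.
rewrite mevalM mulf_eq0 negb_or => /andP[px].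
rewrite rmorph_prod /= => /prodf_neq0 dx.
exists x, (fun i => (\n_(repr (f i))).@[x] / (\d_(repr (f i))).@[x]); split=> // i.
by exists \n_(repr (f i)), \d_(repr (f i)); rewrite tofrac_repr; split=> //; exact: dx.
Qed.

(** * Gram-Schmidt *)

Section SubfieldClosed.
Variables (L : fieldType) (K : set L).
Hypothesis cK : subfield_closed K.

Lemma subfield1 : K 1.
Proof. by case: cK => + _ _; rewrite inE. Qed.

Lemma subfieldB x y : K x -> K y -> K (x - y).
Proof.
by case: cK => _ + _ Kx Ky => /(_ x y); rewrite !inE; apply.
Qed.

Lemma subfield_div x y : K x -> K y -> K (x / y).
Proof.
by case: cK => _ _ + Kx Ky => /(_ x y); rewrite !inE; apply.
Qed.

Lemma subfield0 : K 0.
Proof. by rewrite -(subrr 1); apply: subfieldB; exact: subfield1. Qed.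

Lemma subfieldN x : K x -> K (- x).
Proof. by move=> Kx; rewrite -sub0r; apply: subfieldB => //; exact: subfield0. Qed.

Lemma subfieldD x y : K x -> K y -> K (x + y).
Proof. by move=> Kx Ky; rewrite -(opprK y); apply/subfieldB/subfieldN. Qed.

Lemma subfieldM x y : K x -> K y -> K (x * y).
Proof.
move=> Kx Ky; rewrite -(invrK y) -[y^-1]mul1r; apply: subfield_div => //.
by apply: subfield_div => //; exact: subfield1.
Qed.

Lemma subfield_sum (I : Type) (r : seq I) (P : pred I) (f : I -> L) :
  (forall i, P i -> K (f i)) -> K (\sum_(i <- r | P i) f i).
Proof. by move=> Kf; apply: big_ind => //; [exact: subfield0 | exact: subfieldD]. Qed.

Lemma subfield_prod (I : Type) (r : seq I) (P : pred I) (f : I -> L) :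
  (forall i, P i -> K (f i)) -> K (\prod_(i <- r | P i) f i).
Proof. by move=> Kf; apply: big_ind => //; [exact: subfield1 | exact: subfieldM]. Qed.

Lemma subfieldX x e : K x -> K (x ^+ e).
Proof.
by move=> Kx; elim: e => [|e IH]; rewrite ?exprS; [exact: subfield1 | exact: subfieldM].
Qed.

Lemma subfield_mmap (k : fieldType) (j : {rmorphism k -> L}) (M : nat)
    (f : 'I_M -> L) (q : {mpoly k[M]}) :
  (forall c, K (j c)) -> (forall i, K (f i)) -> K (mmap j f q).
Proof.
move=> Kj Kf; apply: subfield_sum => m _; apply: subfieldM => //.
by apply: subfield_prod => i _; exact: subfieldX.
Qed.

End SubfieldClosed.

(* Symplectic Gram-Schmidt, performed on the Gram matrix [a] of a sequence of
   vectors: at step [k] the plane spanned by the current vectors of index [2k]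
   and [2k+1] is split off. *)
Fixpoint gram_red (F : fieldType) (a : nat -> nat -> F) (k i j : nat) : F :=
  if k is k'.+1 then
    let A := gram_red a k' in
    A i j - (A k'.*2 i * A k'.*2.+1 j - A k'.*2.+1 i * A k'.*2 j)
            / A k'.*2 k'.*2.+1
  else a i j.

Definition gram_pivot (F : fieldType) (a : nat -> nat -> F) (k : nat) : F :=
  gram_red a k k.*2 k.*2.+1.

(** Let e_k be the reduced vector of index 2k, and f_k that of index 2k+1 divided by the pivot. The
    coordinates of a vector v in this symplectic basis are x^k = omega(v, f_k) and y^k = omega(e_k,
    v), written here in terms of the Gram matrix alone. *)
Definition gram_vec (F : fieldType) (a : nat -> nat -> F) (n j : nat) :
  'cV[F]_(n + n) :=
  col_mx (\col_(k < n) - (gram_red a k k.*2.+1 j / gram_pivot a k))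
         (\col_(k < n) gram_red a k k.*2 j).

Definition alternate (F : fieldType) (a : nat -> nat -> F) : Prop :=
  (forall i, a i i = 0) /\ forall i j, a i j = - a j i.

(** Gram matrix of a symplectic basis in the interleaved order e_0, f_0, e_1, f_1, ... *)
Definition std_gram (F : fieldType) (i j : nat) : F :=
  (~~ odd i && (j == i.+1))%:R - (~~ odd j && (i == j.+1))%:R.

Section GramSchmidt.
Variables (F : fieldType) (a : nat -> nat -> F) (n : nat).
Hypothesis piv : forall k, (k < n)%N -> gram_pivot a k != 0.

(** The term of index k in omega is what step k of the reduction subtracts, so the sum
    telescopes. *)
Lemma omega_gram_vec i j :
  omega (gram_vec a n i) (gram_vec a n j) = a i j - gram_red a n i j.
Proof.
rewrite /omega; transitivity (\sum_(k < n) (gram_red a k i j - gram_red a k.+1 i j)).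
  apply: eq_bigr => k _; rewrite /gram_vec !col_mxEu !col_mxEd !mxE /=.
  have := piv (ltn_ord k); rewrite /gram_pivot; set c := gram_red _ _ _ _ => c0.
  by field.
elim: n => [|r IH]; first by rewrite big_ord0 subrr.
by rewrite big_ord_recr IH /= addrA subrK.
Qed.

Hypothesis alt : alternate a.

Lemma gram_red_alternate k : alternate (gram_red a k).
Proof.
elim: k => [|k [IHd IHs]] //=; split=> [i|i j].
  by rewrite IHd [_ * gram_red a k k.*2 i]mulrC subrr mul0r subr0.
by rewrite [gram_red a k i j]IHs; ring.
Qed.

(** Step k kills the rows 2k and 2k+1. A zero row stays zero, since every term of the later
    corrections contains one of its entries. *)
Lemma gram_red_eq0 k i j : (k <= n)%N -> (i < k.*2)%N -> gram_red a k i j = 0.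
Proof.
elim: k i j => [|k IH] i j //= kn; rewrite doubleS !ltnS leq_eqVlt => h.
have [Ad As] := gram_red_alternate k.
have := piv kn; rewrite /gram_pivot; set c := gram_red _ _ _ _ => c0.
case/orP: h => [/eqP ->|]; first by rewrite Ad -/c; field.
rewrite ltnS leq_eqVlt => /orP[/eqP ->|h].
  by rewrite Ad [gram_red a k k.*2.+1 k.*2]As -/c; field.
have i0 j' : gram_red a k i j' = 0 by apply: IH => //; exact: ltnW.
rewrite i0 [gram_red a k k.*2 i]As [gram_red a k k.*2.+1 i]As !i0.
by rewrite !oppr0 !mul0r subrr mul0r subr0.
Qed.

(* Entry [k] of the [j]-th vector is 0 or 1 unless [2k+1 <= j], so the [m] first
   vectors only depend on the Gram matrix of the [m] first ones. *)
Lemma gram_vec_closed (K : set F) (m : nat) :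
  subfield_closed K ->
  (forall i j, (i < m)%N -> (j < m)%N -> (i < n.*2)%N || (j < n.*2)%N -> K (a i j)) ->
  forall j r, (j < m)%N -> K (gram_vec a n j r 0).
Proof.
move=> cK Ka; have [K0 K1] := (subfield0 cK, subfield1 cK).
have red0 k i j : (k <= n)%N -> (i < k.*2)%N || (j < k.*2)%N -> gram_red a k i j = 0.
  move=> kn /orP[h|h]; first exact: gram_red_eq0.
  by rewrite (gram_red_alternate k).2 gram_red_eq0 // oppr0.
have Kred k i j : (k <= n)%N -> (i < m)%N -> (j < m)%N ->
    (i < n.*2)%N || (j < n.*2)%N -> K (gram_red a k i j).
  elim: k i j => [|k IH] i j kn im jm ij; first exact: Ka.
  (* Where the reduced entry is not already 0, both indices are at least 2k+2, so the indices 2k and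
     2k+1 that the step uses are below m. *)
  case: (boolP ((i < k.+1.*2)%N || (j < k.+1.*2)%N)) => h; first by rewrite red0.
  move: h; rewrite negb_or -!leqNgt doubleS => /andP[ki kj] /=.
  have [k1 k2] : (k.*2 < n.*2)%N /\ (k.*2.+1 < n.*2)%N by split; lia.
  apply: subfieldB => //; first by apply: IH => //; lia.
  apply: subfield_div => //; last by apply: IH; rewrite ?k1 //; lia.
  by apply: subfieldB => //; apply: subfieldM => //; apply: IH; rewrite ?k1 ?k2 //; lia.
move=> j r jm; rewrite -(splitK r); case: (split r) => k /=.
  rewrite col_mxEu mxE; apply: subfieldN => //.
  have kn := ltn_ord k.
  have := piv kn; rewrite /gram_pivot => c0.
  case: (ltngtP j k.*2) => h.
  - by rewrite red0 ?(ltnW kn) ?h ?orbT // mul0r.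
  - by apply: subfield_div => //; apply: Kred => //; lia.
  - rewrite h (gram_red_alternate k).2 mulNr mulfV //.
    exact: subfieldN.
rewrite col_mxEd mxE; have kn := ltn_ord k.
case: (ltngtP j k.*2) => h.
- by rewrite red0 ?(ltnW kn) ?h ?orbT.
- by apply: Kred => //; lia.
- by rewrite h (gram_red_alternate k).1.
Qed.

End GramSchmidt.

(** The vectors 2k and 2k+1 are orthogonal to the later ones, so each step leaves the remaining
    block unchanged. *)
Lemma gram_red_std (F : fieldType) (a : nat -> nat -> F) (n : nat) :
  (forall i j, (i < n.*2)%N -> (j < n.*2)%N -> a i j = std_gram F i j) ->
  forall k, (k < n)%N -> gram_pivot a k = 1.
Proof.
move=> aE.
have redE k i j : (k <= n)%N -> (k.*2 <= i < n.*2)%N -> (k.*2 <= j < n.*2)%N ->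
    gram_red a k i j = std_gram F i j.
  elim: k i j => [|k IH] i j kn ki kj /=; first by apply: aE; lia.
  rewrite !IH /=; try lia.
  rewrite /std_gram.
  have -> : (i == k.*2.+1) = false by lia.
  have -> : (j == k.*2.+1) = false by lia.
  have -> : (k.*2 == i.+1) = false by lia.
  have -> : (k.*2 == j.+1) = false by lia.
  by rewrite !andbF subrr !mul0r !mulr0 subrr mul0r subr0.
move=> k kn; rewrite /gram_pivot redE; [|lia..].
rewrite /std_gram eqxx odd_double /=.
have -> : (k.*2 == k.*2.+2) = false by lia.
by rewrite andbF subr0.
Qed.

Section GramRegular.
Variables (k F : fieldType) (iota : {rmorphism k -> F}) (N : nat) (x : 'I_N -> F).
Variables (a : nat -> nat -> {fraction {mpoly k[N]}}) (b : nat -> nat -> F) (n : nat).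
Hypothesis ab : forall i j, regval iota x (a i j) (b i j).
Hypothesis piv : forall r, (r < n)%N -> gram_pivot b r != 0.

Lemma regval_gram_red r i j :
  (r <= n)%N -> regval iota x (gram_red a r i j) (gram_red b r i j).
Proof.
elim: r i j => [|r IH] i j rn //=; have rn' := ltnW rn.
apply: regvalB; first exact: IH.
apply: regval_div; [|exact: IH|exact: piv].
by apply: regvalB; apply: regvalM; apply: IH.
Qed.

Lemma gram_pivot_neq0 r : (r < n)%N -> gram_pivot a r != 0.
Proof.
by move=> rn; apply: (regval_neq0 _ (piv rn)); apply: regval_gram_red; exact: ltnW.
Qed.

End GramRegular.

(** * Conformal symplectic matrices *)

Definition symplectic_mx (S : comNzRingType) (n : nat) : 'M[S]_(n + n) :=
  block_mx 0 1%:M (- 1%:M) 0.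

Section SymplecticMatrix.
Variables (S : comNzRingType) (n : nat).
Local Notation J := (symplectic_mx S n).

Lemma omegaE (u v : 'cV[S]_(n + n)) : omega u v = (u^T *m J *m v) 0 0.
Proof.
rewrite -[u]vsubmxK -[v]vsubmxK tr_col_mx /symplectic_mx mul_row_block.
rewrite !mulmx0 mulmx1 mulmxN mulmx1 add0r addr0 mul_row_col !mxE addrC -big_split.
apply: eq_bigr => k _ /=; rewrite !col_mxEu !col_mxEd !mxE mulNr.
by rewrite addrC.
Qed.

Lemma omega_col r s (A : 'M[S]_(n + n, r)) (B : 'M[S]_(n + n, s)) i j :
  omega (col i A) (col j B) = (A^T *m J *m B) i j.
Proof.
rewrite omegaE tr_col -row_mul; move: (A^T *m _) => M.
by rewrite !mxE; apply: eq_bigr => l _; rewrite !mxE.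
Qed.

Lemma omega_colv r (A : 'M[S]_(n + n, r)) (v : 'cV[S]_(n + n)) i :
  omega (col i A) v = (A^T *m J *m v) i 0.
Proof. by rewrite -omega_col col_id. Qed.

Lemma symplectic_mx_sqr : J *m J = - 1%:M.
Proof.
rewrite mulmx_block !mul0mx !mulmx0 !mulmx1 mul1mx !add0r !addr0.
by rewrite scalar_mx_block opp_block_mx !oppr0.
Qed.

(** The relation g^T J g = c J, with multiplier c, replaces membership in [CSp]: it makes sense over
    R(V^m) and for multipliers that are not positive. *)
Lemma omega_gsp g c (u v : 'cV[S]_(n + n)) :
  g^T *m J *m g = c *: J -> omega (g *m u) (g *m v) = c * omega u v.
Proof.
move=> gJ; rewrite !omegaE trmx_mul -!mulmxA (mulmxA _ g) (mulmxA g^T) mulmxA.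
by rewrite (mulmxA g^T) gJ -scalemxAr -scalemxAl mxE mulmxA.
Qed.

Lemma omega_alt (u : 'cV[S]_(n + n)) : omega u u = 0.
Proof. by apply: big1 => k _; rewrite mulrC subrr. Qed.

Lemma omega_antisym (u v : 'cV[S]_(n + n)) : omega u v = - omega v u.
Proof. by rewrite -sumrN; apply: eq_bigr => k _; ring. Qed.

End SymplecticMatrix.

Lemma map_symplectic_mx (S T : comNzRingType) (f : {rmorphism S -> T}) (n : nat) :
  map_mx f (symplectic_mx S n) = symplectic_mx T n.
Proof. by rewrite map_block_mx map_mxN !map_mx0 !map_mx1. Qed.

Lemma rmorph_omega (S T : comNzRingType) (f : {rmorphism S -> T}) (n : nat)
    (u v : 'cV[S]_(n + n)) : f (omega u v) = omega (map_mx f u) (map_mx f v).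
Proof. by rewrite rmorph_sum; apply: eq_bigr => k _; rewrite !mxE rmorphB !rmorphM. Qed.

Lemma symplectic_mx_unit (F : fieldType) (n : nat) : symplectic_mx F n \in unitmx.
Proof.
have : symplectic_mx F n *m - symplectic_mx F n = 1%:M.
  by rewrite mulmxN symplectic_mx_sqr opprK.
by case/mulmx1_unit.
Qed.

Lemma gsp_unit (F : fieldType) (n : nat) (g : 'M[F]_(n + n)) (c : F) :
  c != 0 -> g^T *m symplectic_mx F n *m g = c *: symplectic_mx F n -> g \in unitmx.
Proof.
move=> c0 gJ; have : (c *: symplectic_mx F n) \in unitmx.
  by rewrite unitmxZ ?unitfE ?symplectic_mx_unit.
by rewrite -gJ unitmx_mul => /andP[].
Qed.

(** The matrix g maps the basis X_0, ..., X_(2n-1) to the first 2n Gram-Schmidt vectors; it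
    multiplies omega by c because the Gram matrices agree up to c. The other vectors follow, being
    determined by their pairings with a basis. *)
Lemma gram_vec_transport (F : fieldType) (n : nat) (a : nat -> nat -> F) (c : F)
    (X : nat -> 'cV[F]_(n + n)) :
  (forall k, (k < n)%N -> gram_pivot a k != 0) -> c != 0 ->
  (forall i j, a i j = c * omega (X i) (X j)) ->
  (\matrix_(r, j < n + n) X j r 0) \in unitmx ->
  exists2 g : 'M[F]_(n + n),
    g^T *m symplectic_mx F n *m g = c *: symplectic_mx F n &
    forall j, g *m X j = gram_vec a n j.
Proof.
set U := \matrix_(_, _) _; set J := symplectic_mx F n => piv c0 aE Uu.
have alt : alternate a.
  by split=> [i|i j]; rewrite !aE ?omega_alt ?mulr0 // omega_antisym mulrN.
pose P : 'M[F]_(n + n) := \matrix_(r, j < n + n) gram_vec a n j r 0.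
have colU j : col j U = X j by apply/colP => r; rewrite !mxE.
have colPj j : col j P = gram_vec a n j by apply/colP => r; rewrite mxE mxE.
(* For i < 2n the remainder [gram_red a n i j] vanishes, so the pairing is exactly [a i j]. *)
have PC j : P^T *m J *m gram_vec a n j = c *: (U^T *m J *m X j).
  apply/colP => i; rewrite [RHS]mxE -!omega_colv colU colPj omega_gram_vec //.
  by rewrite (gram_red_eq0 piv alt) ?subr0 // -addnn.
have PP : P^T *m J *m P = c *: (U^T *m J *m U).
  apply/matrixP => i j; rewrite -omega_col [RHS]mxE -omega_col !colPj !colU.
  have := congr1 (fun M : 'cV[F]_(n + n) => M i 0) (PC j).
  by rewrite [X in _ = X]mxE -!omega_colv colPj colU.
have PJu : P^T *m J \in unitmx.
  have : c *: (U^T *m J *m U) \in unitmx.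
    by rewrite unitmxZ ?unitfE // !unitmx_mul unitmx_tr Uu symplectic_mx_unit.
  by rewrite -PP unitmx_mul => /andP[].
exists (P *m invmx U).
  rewrite trmx_mul -!mulmxA (mulmxA J) (mulmxA P^T) (mulmxA P^T) PP.
  rewrite -scalemxAl -scalemxAr; congr (_ *: _).
  by rewrite -!mulmxA mulmxV // mulmx1 mulmxA -trmx_mul mulmxV // trmx1 mul1mx.
(* As P^T J is invertible, it suffices to compare the pairings with the columns of P. *)
move=> j; apply: (can_inj (mulKmx PJu)).
rewrite PC -mulmxA (mulmxA (P^T *m J)) PP -scalemxAl; congr (_ *: _).
by rewrite -!mulmxA (mulmxA U) mulmxV // mul1mx.
Qed.

Lemma cross_cancel (S : idomainType) (a b c d u v : S) :
  v != 0 -> a * v = u * b -> u * c = d * v -> a * c = d * b.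
Proof.
move=> v0 e1 e2; apply: (mulIf v0).
by rewrite mulrAC e1 mulrAC e2 mulrAC.
Qed.

Lemma horner_mmap (R : comNzRingType) (N : nat) (h : 'I_N -> {poly R})
    (p : {mpoly R[N]}) (s : R) :
  (mmap polyC h p).[s] = p.@[fun i => (h i).[s]].
Proof.
rewrite mevalE horner_sum; apply: eq_bigr => m _.
rewrite hornerM hornerC horner_prod; congr (_ * _).
by apply: eq_bigr => i _; rewrite horner_exp.
Qed.

Definition dilation (S : comNzRingType) (n : nat) (s : S) : 'M[S]_(n + n) :=
  block_mx 1%:M 0 0 s%:M.

Lemma dilation_gsp (S : comNzRingType) (n : nat) (s : S) :
  (dilation n s)^T *m symplectic_mx S n *m dilation n s = s *: symplectic_mx S n.
Proof.
rewrite /dilation /symplectic_mx tr_block_mx !trmx0 trmx1 tr_scalar_mx.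
rewrite !mulmx_block !(mul0mx, mulmx0, mulmx1, mul1mx, addr0, add0r).
rewrite scale_block_mx !scaler0 mulmxN mulmx1 scalerN scalemx1.
by [].
Qed.

Lemma map_dilation (S T : comNzRingType) (f : {rmorphism S -> T}) (n : nat) (s : S) :
  map_mx f (dilation n s) = dilation n (f s).
Proof. by rewrite map_block_mx !map_mx0 !map_mx1 map_scalar_mx. Qed.

Lemma scale_gsp (F : fieldType) (n : nat) (g : 'M[F]_(n + n)) (t c : F) :
  g^T *m symplectic_mx F n *m g = c *: symplectic_mx F n ->
  (t *: g)^T *m symplectic_mx F n *m (t *: g) = (t ^+ 2 * c) *: symplectic_mx F n.
Proof.
have -> : (t *: g)^T = t *: g^T by apply/matrixP => i j; rewrite !mxE.
by move=> gJ; rewrite -!scalemxAl -scalemxAr gJ !scalerA expr2.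
Qed.

Lemma gsp_mul (F : fieldType) (n : nat) (g h : 'M[F]_(n + n)) (c d : F) :
  g^T *m symplectic_mx F n *m g = c *: symplectic_mx F n ->
  h^T *m symplectic_mx F n *m h = d *: symplectic_mx F n ->
  (g *m h)^T *m symplectic_mx F n *m (g *m h) = (c * d) *: symplectic_mx F n.
Proof.
move=> gJ hJ; rewrite trmx_mul -!mulmxA (mulmxA (symplectic_mx F n)).
by rewrite !(mulmxA g^T) gJ -scalemxAl -scalemxAr mulmxA hJ scalerA.
Qed.

(** * Invariant fractions under multipliers of either sign *)

Section Invariance.
Variables (R : realType) (n m : nat).
Local Notation J := (symplectic_mx R n).

Lemma CSp_gsp (g : 'M[R]_(n + n)) :
  @CSp R n g -> exists2 c, 0 < c & g^T *m J *m g = c *: J.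
Proof.
move=> [h [t [[_ hP] t0 ->]]]; exists (t ^+ 2); first exact: exprn_gt0.
have hJ : h^T *m J *m h = 1 *: J.
  rewrite scale1r.
  apply/matrixP => i j; rewrite -omega_col !colE hP -[delta_mx j 0]mul1mx.
  by rewrite -[delta_mx i 0]mul1mx -!colE omega_col trmx1 mul1mx mulmx1.
by rewrite (scale_gsp _ hJ) mulr1.
Qed.

(** A scaling by t multiplies omega by t^2, so dividing g by the square root of c leaves a
    symplectic matrix. *)
Lemma gsp_CSp (g : 'M[R]_(n + n)) c :
  0 < c -> g^T *m J *m g = c *: J -> @CSp R n g.
Proof.
move=> c0 gJ; have s0 : 0 < Num.sqrt c by rewrite sqrtr_gt0.
exists ((Num.sqrt c)^-1 *: g), (Num.sqrt c); split=> //; last first.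
  by rewrite scalerA mulfV ?scale1r // gt_eqF.
have hJ : ((Num.sqrt c)^-1 *: g)^T *m J *m ((Num.sqrt c)^-1 *: g) = 1 *: J.
  by rewrite (scale_gsp _ gJ) exprVn sqr_sqrtr ?ltW // mulVf // gt_eqF.
split; first by apply: gsp_unit hJ; exact: oner_neq0.
by move=> u v; rewrite (omega_gsp _ _ hJ) mul1r.
Qed.

Definition mx_point (F : comNzRingType) (A : 'M[F]_(n + n, m))
    (k : 'I_((n + n) * m)) : F :=
  mxvec A 0 k.

Lemma meval_pullback (g : 'M[R]_(n + n)) (p : polyV R n m) (A : 'M[R]_(n + n, m)) :
  (poly_pullback g p).@[mx_point A] = p.@[mx_point (g *m A)].
Proof.
rewrite comp_mpoly_meval; apply: meval_eq => k; rewrite tnth_mktuple.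
case/mxvec_indexP: k => k i; rewrite act_coordE raddf_sum /mx_point mxvecE mxE.
by apply: eq_bigr => l _; rewrite /= mevalM mevalC mevalXU mxvecE.
Qed.

Lemma poly_pullbackM (g : 'M[R]_(n + n)) (p q : polyV R n m) :
  poly_pullback g (p * q) = poly_pullback g p * poly_pullback g q.
Proof. exact: rmorphM. Qed.

Lemma poly_pullbackB (g : 'M[R]_(n + n)) (p q : polyV R n m) :
  poly_pullback g (p - q) = poly_pullback g p - poly_pullback g q.
Proof. exact: rmorphB. Qed.

Lemma mx_point_surj (F : comNzRingType) (x : 'I_((n + n) * m) -> F) :
  exists A, x = mx_point A.
Proof.
exists (vec_mx (\row_k x k)); apply: funext => k.
by rewrite /mx_point vec_mxK mxE.
Qed.

Lemma polyV_nonroot (p : polyV R n m) :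
  p != 0 -> exists A : 'M[R]_(n + n, m), p.@[mx_point A] != 0.
Proof.
move=> /mpoly_nonroot[x]; have [A ->] := mx_point_surj x.
by exists A.
Qed.

Lemma polyV_ext (p q : polyV R n m) :
  (forall A : 'M[R]_(n + n, m), p.@[mx_point A] = q.@[mx_point A]) -> p = q.
Proof.
move=> pq; apply/eqP; rewrite -subr_eq0; apply/negPn/negP => /polyV_nonroot[A].
by rewrite mevalB pq subrr eqxx.
Qed.

Section InvariantFraction.
Variables p q : polyV R n m.
Hypothesis q0 : q != 0.
Hypothesis inv : @invariant_field R n m (@CSp R n) (tofrac p / tofrac q).

Lemma invariant_cross (g : 'M[R]_(n + n)) c :
  0 < c -> g^T *m J *m g = c *: J ->
  poly_pullback g p * q = p * poly_pullback g q.
Proof.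
move=> c0 gJ; have gu : g \in unitmx by apply: gsp_unit gJ; rewrite gt_eqF.
have := inv (gsp_CSp c0 gJ); rewrite rat_pullback_div // => /eqP.
rewrite eqr_div ?tofrac_eq0 ?poly_pullback_eq0 // -!tofracM tofrac_eq => /eqP ->.
by [].
Qed.

(** At a fixed point A both sides are polynomials in s. They agree at all positive integers, hence
    for every s, negative values included. *)
Lemma invariant_dilation s :
  poly_pullback (dilation n s) p * q = p * poly_pullback (dilation n s) q.
Proof.
apply: polyV_ext => A; rewrite !mevalM !meval_pullback.
(* The image of A under the dilation with indeterminate parameter: a point over R[X] whose value at
   t is the image under the dilation of parameter t. *)
pose h := mx_point (dilation n 'X *m map_mx polyC A).
have hE (r : polyV R n m) t :
    (mmap polyC h r).[t] = r.@[mx_point (dilation n t *m A)].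
  rewrite horner_mmap; apply: meval_eq => k; case/mxvec_indexP: k => k i.
  rewrite /h /mx_point !mxvecE; set M := dilation n 'X *m _.
  transitivity (map_mx (horner_eval t) M k i); first by rewrite [RHS]mxE.
  rewrite map_mxM map_dilation /= /horner_eval hornerX -map_mx_comp.
  congr (fun_of_matrix (_ *m _) k i). apply/matrixP => ? ?. by rewrite mxE /= hornerC.
pose P := mmap polyC h p * (q.@[mx_point A])%:P - (p.@[mx_point A])%:P * mmap polyC h q.
suff /eqP P0 : P == 0.
  have : P.[s] = 0 by rewrite P0 horner0.
  by rewrite /P hornerD hornerN !hornerM !hornerC !hE => /subr0_eq.
apply/negPn/negP => /poly_nat_nonroot[k].
rewrite /P hornerD hornerN !hornerM !hornerC !hE.
have := congr1 (meval (mx_point A))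
  (invariant_cross (ltr0Sn _ k) (dilation_gsp n k.+1%:R)).
by rewrite !mevalM !meval_pullback => ->; rewrite subrr eqxx.
Qed.

(** When c < 0, g factors as d g' with d the dilation of parameter -1 and g' of multiplier -c > 0;
    the identities for d and g' are then combined. *)
Lemma invariant_gsp (g : 'M[R]_(n + n)) c :
  c != 0 -> g^T *m J *m g = c *: J ->
  poly_pullback g p * q = p * poly_pullback g q.
Proof.
move=> c0 gJ; have [cp|cn] := boolP (0 < c); first exact: invariant_cross cp gJ.
have cn' : 0 < - c by rewrite oppr_gt0 lt_neqAle c0 leNgt.
pose d := dilation n (-1 : R); pose g' := d *m g.
have dd : d *m d = 1%:M.
  rewrite /d /dilation mulmx_block !mul0mx !mulmx0 mul1mx !add0r !addr0.
  by rewrite -scalar_mxM mulrNN mulr1 -scalar_mx_block.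
have g'J : g'^T *m J *m g' = - c *: J.
  by rewrite -mulN1r; apply: gsp_mul (dilation_gsp _ _) gJ.
have g'u : g' \in unitmx by apply: gsp_unit g'J; rewrite gt_eqF.
have gE : d *m g' = g by rewrite /g' mulmxA dd mul1mx.
have := invariant_cross cn' g'J.
set pg := poly_pullback g' p; set qg := poly_pullback g' q.
move=> e'; have qg0 : qg != 0 by rewrite poly_pullback_eq0.
(* Pulling the identity for d back by g' relates the pullbacks by g to those by g'. The identity
   [e'] returns to p and q after cancelling [qg]. *)
have := congr1 (poly_pullback g') (invariant_dilation (-1)).
rewrite !poly_pullbackM !poly_pullback_comp -/d gE => e.
exact: cross_cancel qg0 e e'.
Qed.

End InvariantFraction.
End Invariance.

(** * The moving frame *)

(** For j < 2n, the standard basis in the interleaved order x^1, y^1, x^2, y^2, ..., so that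
    consecutive pairs span the planes split off by Gram-Schmidt. *)
Definition std_vec (S : comNzRingType) (n j : nat) : 'cV[S]_(n + n) :=
  \col_r (r == (if odd j then n + j./2 else j./2)%N :> nat)%:R.

Definition ext_col (S : comNzRingType) (n m : nat) (A : 'M[S]_(n + n, m)) (j : nat) :
  'cV[S]_(n + n) :=
  if insub j is Some j' then col j' A else std_vec S n j.

Lemma ext_col_ord (S : comNzRingType) (n m : nat) (A : 'M[S]_(n + n, m)) (j : 'I_m) :
  ext_col A j = col j A.
Proof. by rewrite /ext_col valK. Qed.

Definition std_point (S : comNzRingType) (n m : nat) : 'M[S]_(n + n, m) :=
  \matrix_(r, j) std_vec S n j r 0.

Lemma ext_col_std (S : comNzRingType) (n m j : nat) :
  ext_col (std_point S n m) j = std_vec S n j.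
Proof.
rewrite /ext_col; case: insubP => // j' _ <-.
by apply/colP => r; rewrite !mxE.
Qed.

Lemma omega_std_vec (F : fieldType) (n i j : nat) :
  (i < n.*2)%N -> (j < n.*2)%N ->
  omega (std_vec F n i) (std_vec F n j) = std_gram F i j.
Proof.
move=> ni nj; rewrite /omega /std_gram.
have E k : std_vec F n i (lshift n k) 0 * std_vec F n j (rshift n k) 0 -
    std_vec F n i (rshift n k) 0 * std_vec F n j (lshift n k) 0 =
    (k == i./2 :> nat)%:R * ((~~ odd i && (j == i.+1))%:R - (~~ odd j && (i == j.+1))%:R).
  have kn := ltn_ord k; rewrite !mxE /= -!natrM !mulnb.
  have -> : (k == (if odd i then n + i./2 else i./2)%N :> nat) &&
      ((n + k)%N == (if odd j then n + j./2 else j./2)%N) =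
      (k == i./2 :> nat) && (~~ odd i && (j == i.+1)).
    by case: (boolP (odd i)); case: (boolP (odd j)) => /=; lia.
  have -> : ((n + k)%N == (if odd i then n + i./2 else i./2)%N) &&
      (k == (if odd j then n + j./2 else j./2)%N :> nat) =
      (k == i./2 :> nat) && (~~ odd j && (i == j.+1)).
    by case: (boolP (odd i)); case: (boolP (odd j)) => /=; lia.
  by rewrite mulrBr -!natrM !mulnb.
under eq_bigr => k _ do rewrite E.
rewrite -mulr_suml; have i2 : (i./2 < n)%N by lia.
rewrite (bigD1 (Ordinal i2)) //= eqxx big1 ?addr0 ?mul1r // => k.
by rewrite -val_eqE /= => /negPf ->.
Qed.

(** The matrix is a permutation matrix, so its transpose is its inverse. *)
Lemma std_vec_unit (F : fieldType) (n : nat) :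
  (\matrix_(r, j < n + n) std_vec F n j r 0) \in unitmx.
Proof.
set U := \matrix_(_, _) _; suff : U^T *m U = 1%:M by case/mulmx1_unit.
apply/matrixP => i j; rewrite !mxE.
have := ltn_ord i; have := ltn_ord j; move=> jn ni.
have fi : ((if odd i then n + i./2 else i./2) < n + n)%N by case: (boolP (odd i)); lia.
rewrite (bigD1 (Ordinal fi)) //= big1 ?addr0 => [|r].
  rewrite !mxE /= eqxx mul1r; congr (_%:R); rewrite -val_eqE /=; congr nat_of_bool.
  by case: (boolP (odd i)); case: (boolP (odd j)) => /=; lia.
by rewrite -val_eqE /= !mxE => /negPf ->; rewrite mul0r.
Qed.

Section GenericGram.
Variables (R : realType) (n m : nat).
Hypothesis hm : (2 <= m)%N.
Local Notation L := (ratV R n m).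
Local Notation J := (symplectic_mx L n).
Local Notation i1 := (Ordinal (ltnW hm)).
Local Notation i2 := (Ordinal hm).

Definition generic_mx : 'M[L]_(n + n, m) := map_mx (@tofrac _) (generic_point R n m).

Lemma omega_ijE i j : omega_ij R n i j = omega (col i generic_mx) (col j generic_mx).
Proof. by rewrite /omega_ij (rmorph_omega (@tofrac _)) !map_col. Qed.

(** Entries with an index at least m involve the completing constant vectors and need not be
    invariant; [gram_vec_closed] asks nothing of them. *)
Definition generic_gram (i j : nat) : L :=
  (omega_ij R n i1 i2)^-1 * omega (ext_col generic_mx i) (ext_col generic_mx j).

Lemma generic_gram_ord (i j : 'I_m) :
  generic_gram i j = omega_ij R n i j / omega_ij R n i1 i2.
Proof. by rewrite /generic_gram !ext_col_ord -omega_ijE mulrC. Qed.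

Section Regular.
Variables (F : fieldType) (iota : {rmorphism R -> F}) (A : 'M[F]_(n + n, m)).
Local Notation rv := (regval iota (mx_point A)).

Lemma regval_generic k i : rv (generic_mx k i) (A k i).
Proof.
rewrite !mxE; have := regval_tofrac iota (mx_point A) 'X_(mxvec_index k i).
by rewrite mmapX mmap1U /mx_point mxvecE.
Qed.

Lemma regval_nat_of_bool (b : bool) : rv b%:R b%:R.
Proof. by case: b; [apply: regval1 | apply: regval0]. Qed.

Lemma regval_ext_col j r : rv (ext_col generic_mx j r 0) (ext_col A j r 0).
Proof.
rewrite /ext_col; case: insubP => [j' _ _|_]; rewrite [X in rv X _]mxE [X in rv _ X]mxE.
  exact: regval_generic.
exact: regval_nat_of_bool.
Qed.

Lemma regval_omega (u v : 'cV[L]_(n + n)) (u' v' : 'cV[F]_(n + n)) :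
  (forall r, rv (u r 0) (u' r 0)) -> (forall r, rv (v r 0) (v' r 0)) ->
  rv (omega u v) (omega u' v').
Proof.
by move=> ru rv'; apply: regval_sum => k _; apply: regvalB; apply: regvalM.
Qed.

Lemma regval_omega_ij i j : rv (omega_ij R n i j) (omega (col i A) (col j A)).
Proof.
by rewrite omega_ijE -!ext_col_ord; apply: regval_omega => r; apply: regval_ext_col.
Qed.

Lemma regval_generic_gram i j : omega (col i1 A) (col i2 A) != 0 ->
  rv (generic_gram i j)
     ((omega (col i1 A) (col i2 A))^-1 * omega (ext_col A i) (ext_col A j)).
Proof.
move=> A0; apply: regvalM; first by apply: regvalV => //; apply: regval_omega_ij.
by apply: regval_omega => r; apply: regval_ext_col.
Qed.

Lemma regval_symplectic i j : rv (J i j) (symplectic_mx F n i j).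
Proof.
rewrite -(map_symplectic_mx (constV R n m)) -(map_symplectic_mx iota).
rewrite [X in rv X _]mxE [X in rv _ X]mxE.
exact: regval_const.
Qed.

(** The relation is polynomial in the entries of g and in c, so it survives evaluation at a point
    where these are regular. *)
Lemma regval_gsp (g : 'M[L]_(n + n)) (c : L) (g' : 'M[F]_(n + n)) (c' : F) :
  (forall i j, rv (g i j) (g' i j)) -> rv c c' -> g^T *m J *m g = c *: J ->
  g'^T *m symplectic_mx F n *m g' = c' *: symplectic_mx F n.
Proof.
move=> rg rc gJ; apply/matrixP => i j.
have rgt i' j' : rv (g^T i' j') (g'^T i' j') by rewrite [X in rv X _]mxE [X in rv _ X]mxE.
have := regval_mulmx (regval_mulmx rgt regval_symplectic) rg i j.
rewrite gJ => /regval_uniq; apply.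
by rewrite [X in rv X _]mxE [X in rv _ X]mxE; apply/regvalM/regval_symplectic.
Qed.
End Regular.
End GenericGram.

(** * Invariants as functions of the normal form *)

Section Generation.
Variables (R : realType) (n m : nat).
Hypotheses (hn : (1 <= n)%N) (hm : (2 <= m)%N).
Local Notation L := (ratV R n m).
Local Notation J := (symplectic_mx L n).
Local Notation i1 := (Ordinal (ltnW hm)).
Local Notation i2 := (Ordinal hm).
Local Notation X := (generic_mx R n m).
Local Notation a12 := (omega_ij R n i1 i2).

Lemma omega_std12 (F : fieldType) :
  omega (col i1 (std_point F n m)) (col i2 (std_point F n m)) = 1.
Proof.
rewrite -!ext_col_ord !ext_col_std omega_std_vec /=; [|lia..].
by rewrite /std_gram /= subr0.
Qed.

Lemma omega12_neq0 : a12 != 0.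
Proof.
apply: (regval_neq0 (regval_omega_ij idfun (std_point R n m) i1 i2)).
by rewrite omega_std12 oner_eq0.
Qed.

(** At the standard point a_12 = 1 and the Gram matrix is standard in the indices below 2n, so all
    pivots take the value 1 there. *)
Lemma generic_pivot k : (k < n)%N -> gram_pivot (generic_gram R n hm) k != 0.
Proof.
have o0 : omega (col i1 (std_point R n m)) (col i2 (std_point R n m)) != 0.
  by rewrite omega_std12 oner_eq0.
apply: (gram_pivot_neq0 (fun i j => regval_generic_gram idfun i j o0)) => r rn.
rewrite (@gram_red_std _ _ n) ?oner_eq0 // => i j ni nj.
by rewrite omega_std12 invr1 mul1r !ext_col_std omega_std_vec.
Qed.

Lemma generic_unit : (\matrix_(r, j < n + n) ext_col X j r 0) \in unitmx.
Proof.
rewrite unitmxE unitfE; pose B := std_point R n m.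
have rd := @regval_det _ _ idfun _ (mx_point B) _
  (\matrix_(r, j < n + n) ext_col X j r 0) (\matrix_(r, j < n + n) ext_col B j r 0).
apply: (regval_neq0 (rd _)) => [i j|].
  by rewrite [X in regval _ _ X _]mxE [X in regval _ _ _ X]mxE; apply: regval_ext_col.
have -> : \matrix_(r, j < n + n) ext_col B j r 0 =
          \matrix_(r, j < n + n) std_vec R n j r 0.
  by apply/matrixP => i j; rewrite mxE [RHS]mxE ext_col_std.
by rewrite -unitfE -unitmxE std_vec_unit.
Qed.

Lemma generic_frame : exists2 g : 'M[L]_(n + n),
  g^T *m J *m g = a12^-1 *: J &
  forall (r : 'I_(n + n)) (j : 'I_m),
    (g *m X) r j = gram_vec (generic_gram R n hm) n j r 0.
Proof.
have c0 : a12^-1 != 0 by rewrite invr_eq0 omega12_neq0.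
have [|g gJ gX] := @gram_vec_transport _ n _ _ (ext_col X) generic_pivot c0 _ generic_unit.
  by [].
exists g => // r j.
by rewrite -gX ext_col_ord colE mulmxA -colE [RHS]mxE.
Qed.

Lemma generic_gram_alt : alternate (generic_gram R n hm).
Proof.
by split=> [i|i j]; rewrite /generic_gram ?omega_alt ?mulr0 // omega_antisym mulrN.
Qed.

Lemma invariant_in_subfield (K : set L) :
  subfield_closed K -> (forall c, K (constV R n m c)) ->
  (forall i j : 'I_m, (i < n.*2)%N || (j < n.*2)%N -> K (omega_ij R n i j / a12)) ->
  forall f, @invariant_field R n m (@CSp R n) f -> K f.
Proof.
move=> cK Kc KI f finv.
have [g gJ gX] := generic_frame.
have KgX r j : K ((g *m X) r j).
  rewrite gX; apply: (@gram_vec_closed _ _ n generic_pivot generic_gram_alt K m cK) => //.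
  move=> i' j' im jm ij; rewrite (generic_gram_ord R n hm (Ordinal im) (Ordinal jm)).
  exact: KI.
pose p := \n_(repr f); pose q := \d_(repr f).
have q0 : q != 0 by exact: denom_ratioP.
have fE : tofrac p / tofrac q = f by exact: tofrac_repr.
(* The functions to be made regular at a common point: the entries of g, and an auxiliary w. *)
pose fam (w : L) (o : option ('I_(n + n) * 'I_(n + n))) :=
  if o is Some ij then g ij.1 ij.2 else w.
have regular (w : L) (u : polyV R n m) : u != 0 ->
    exists (A : 'M[R]_(n + n, m)) (g' : 'M[R]_(n + n)) (w' c : R),
    [/\ u.@[mx_point A] != 0,
        forall i j, regval idfun (mx_point A) (g i j) (g' i j),
        regval idfun (mx_point A) w w', c != 0 &
        g'^T *m symplectic_mx R n *m g' = c *: symplectic_mx R n].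
  move=> u0.
  (* The factor a_12 makes the multiplier 1 / a_12 of g regular at the chosen point, with a nonzero
     value. *)
  have uo0 : u * omega (col i1 (generic_point R n m)) (col i2 (generic_point R n m)) != 0.
    by rewrite mulf_neq0 // -tofrac_eq0 omega12_neq0.
  have [x [v [ux vx]]] := regular_point (fam w) uo0.
  have [A xA] := mx_point_surj x; subst x.
  move: ux; rewrite mevalM mulf_eq0 negb_or => /andP[ux ox].
  have rg i j : regval idfun (mx_point A) (g i j) ((\matrix_(i, j) v (Some (i, j))) i j).
    by rewrite mxE; exact: (vx (Some (i, j))).
  have ra : regval idfun (mx_point A) a12^-1
     (omega (col i1 (generic_point R n m)) (col i2 (generic_point R n m))).@[mx_point A]^-1.
    by apply: regvalV => //; apply: regval_tofrac.
  have g'J := regval_gsp rg ra gJ.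
  exists A, (\matrix_(i, j) v (Some (i, j))), (v None); eexists; split; last exact: g'J.
  - exact: ux.
  - exact: rg.
  - exact: (vx None).
  - by rewrite invr_eq0; exact: ox.
(* The point x0 of the overview; the auxiliary function is the dummy 0. *)
have [A0 [g0 [_ [c0 [qA0 rg0 _ c00 g0J]]]]] := regular 0 q q0.
have g0u : g0 \in unitmx by apply: gsp_unit g0J.
pose h := invmx g0.
have hJ : h^T *m symplectic_mx R n *m h = c0^-1 *: symplectic_mx R n.
  rewrite -[LHS]scale1r -(mulVf c00) -scalerA; congr (_ *: _).
  rewrite scalemxAl scalemxAr -g0J -!mulmxA mulmxV // mulmx1.
  by rewrite (mulmxA h^T) -trmx_mul mulmxV // trmx1 mul1mx.
(* Normalized so that C takes the value A0 at A0. As h is real, the entries of C stay in K. *)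
pose C := map_mx (constV R n m) h *m (g *m X).
have KC k : K (mx_point C k).
  case/mxvec_indexP: k => k i; rewrite /mx_point mxvecE /C.
  move: (g *m X) KgX => Y KY; rewrite mxE.
  apply: subfield_sum => // l _.
  by apply: subfieldM; [done|rewrite ?mxE; exact: Kc|exact: KY].
have regC (A : 'M[R]_(n + n, m)) (g' : 'M[R]_(n + n)) (u : polyV R n m) :
    (forall i j, regval idfun (mx_point A) (g i j) (g' i j)) ->
    regval idfun (mx_point A) (mmap (constV R n m) (mx_point C) u)
      (u.@[mx_point (h *m (g' *m A))]).
  move=> rg'; apply: regval_mmap => // k; case/mxvec_indexP: k => k i.
  rewrite /mx_point !mxvecE; apply: regval_mulmx => [i' j'|].
    by rewrite mxE; exact: regval_const.
  by apply: regval_mulmx => // i' j'; apply: regval_generic.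
have qC0 : mmap (constV R n m) (mx_point C) q != 0.
  by apply: (regval_neq0 (regC _ _ _ rg0)); rewrite /h mulKmx.
pose W := mmap (constV R n m) (mx_point C) p * tofrac q -
          tofrac p * mmap (constV R n m) (mx_point C) q.
have W0 : W = 0.
  apply/eqP/negPn/negP => Wn0.
  (* If W were nonzero, its inverse could be made regular at A, which forbids W to vanish there. But
     [h *m g'] is a real matrix with nonzero multiplier, so invariance gives W the value 0 at A. *)
  have [A [g' [w [c [_ rg' rw c_0 g'J]]]]] := regular W^-1 q q0.
  have hgJ : (h *m g')^T *m symplectic_mx R n *m (h *m g') =
      (c0^-1 * c) *: symplectic_mx R n.
    exact: gsp_mul.
  have finv' : @invariant_field R n m (@CSp R n) (tofrac p / tofrac q) by rewrite fE.
  have cc0 : c0^-1 * c != 0 by rewrite mulf_neq0 ?invr_eq0.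
  have e := invariant_gsp q0 finv' cc0 hgJ.
  have := congr1 (meval (mx_point A)) e; rewrite !mevalM !meval_pullback -mulmxA => e'.
  have rW : regval idfun (mx_point A) W 0.
    rewrite -(subrr (p.@[mx_point A] * q.@[mx_point (h *m (g' *m A))])) -{1}e'.
    by apply: regvalB; apply: regvalM => //; (apply: regC || apply: regval_tofrac).
  have := regvalM rW rw; rewrite mulfV // mul0r => /regval_uniq /(_ (regval1 _ _)).
  by move/esym/eqP; rewrite oner_eq0.
have -> : f = mmap (constV R n m) (mx_point C) p / mmap (constV R n m) (mx_point C) q.
  by apply/eqP; rewrite -fE eqr_div ?tofrac_eq0 // eq_sym -subr_eq0; apply/eqP.
by apply: subfield_div => //; apply: subfield_mmap.
Qed.

End Generation.

(** * The field of invariants *)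

Lemma adjoin_subfield (k L : fieldType) (iota : {rmorphism k -> L}) (S : set L) :
  subfield_closed (adjoin iota S).
Proof.
split=> [|x y|x y]; rewrite !inE.
- by move=> M [cM _]; exact: subfield1.
- by move=> Kx Ky M MP; apply: (subfieldB MP.1); [exact: Kx | exact: Ky].
- by move=> Kx Ky M MP; apply: (subfield_div MP.1); [exact: Kx | exact: Ky].
Qed.

Lemma adjoin_const (k L : fieldType) (iota : {rmorphism k -> L}) (S : set L) c :
  adjoin iota S (iota c).
Proof. by move=> M [_ SM]; apply: SM; left; exists c. Qed.

Lemma adjoin_gen (k L : fieldType) (iota : {rmorphism k -> L}) (S : set L) x :
  S x -> adjoin iota S x.
Proof. by move=> Sx M [_ SM]; apply: SM; right. Qed.

Lemma algebraic_mem (L : fieldType) (K : set L) x :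
  subfield_closed K -> K x -> algebraic_over K x.
Proof.
move=> cK Kx; exists ('X - x%:P); split; first by rewrite polyXsubC_eq0.
  move=> i; rewrite coefB coefX coefC; apply: (subfieldB cK).
    by case: eqP => _; [exact: subfield1 | exact: subfield0].
  by case: eqP => _ //; exact: subfield0.
by rewrite root_XsubC.
Qed.

Section InvariantField.
Variables (R : realType) (n m : nat).
Local Notation L := (ratV R n m).

Lemma rat_pullbackB (g : 'M[R]_(n + n)) (f h : L) : g \in unitmx ->
  rat_pullback g (f - h) = rat_pullback g f - rat_pullback g h.
Proof.
move=> gu; rewrite -[f in LHS]tofrac_repr -[h in LHS]tofrac_repr.
have d0 (u : L) : \d_(repr u) != 0 by exact: denom_ratioP.
rewrite -mulNr addf_div ?tofrac_eq0 // mulNr -!tofracM -tofracB.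
rewrite rat_pullback_div ?mulf_neq0 // poly_pullbackB !poly_pullbackM.
rewrite /rat_pullback -[in RHS]mulNr addf_div ?tofrac_eq0 ?poly_pullback_eq0 //.
by rewrite mulNr -!tofracM -tofracB.
Qed.

Lemma rat_pullback_const (g : 'M[R]_(n + n)) c : g \in unitmx ->
  rat_pullback g (constV R n m c) = constV R n m c.
Proof.
move=> gu; rewrite -[X in rat_pullback _ X]divr1 -tofrac1 /=.
rewrite rat_pullback_div ?oner_neq0 //.
have pC (b : R) : poly_pullback g (b%:MP : polyV R n m) = b%:MP by exact: comp_mpolyC.
by rewrite -mpolyC1 !pC mpolyC1 tofrac1 divr1.
Qed.

Lemma rat_pullback0 (g : 'M[R]_(n + n)) : g \in unitmx ->
  rat_pullback g (0 : L) = 0.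
Proof. by move=> gu; rewrite -(rmorph0 (constV R n m)) rat_pullback_const. Qed.

Lemma rat_pullback_divf (g : 'M[R]_(n + n)) (f h : L) : g \in unitmx ->
  rat_pullback g (f / h) = rat_pullback g f / rat_pullback g h.
Proof.
move=> gu; have [->|h0] := eqVneq h 0.
  by rewrite invr0 mulr0 rat_pullback0 // invr0 mulr0.
have d0 (u : L) : \d_(repr u) != 0 by exact: denom_ratioP.
have n0 : \n_(repr h) != 0.
  by apply: contraNneq h0 => e; rewrite -[h]tofrac_repr e tofrac0 mul0r.
rewrite -[f in LHS]tofrac_repr -[h in LHS]tofrac_repr invf_div mulf_div -!tofracM.
rewrite rat_pullback_div ?mulf_neq0 // !poly_pullbackM.
by rewrite /rat_pullback invf_div mulf_div -!tofracM.
Qed.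

Lemma CSp_unit (g : 'M[R]_(n + n)) : @CSp R n g -> g \in unitmx.
Proof. by case/CSp_gsp => c c0; apply: gsp_unit; rewrite gt_eqF. Qed.

Lemma invariant_subfield : subfield_closed (@invariant_field R n m (@CSp R n)).
Proof.
split=> [|x y|x y]; rewrite !inE.
- by move=> g /CSp_unit gu; rewrite -(rmorph1 (constV R n m)) rat_pullback_const.
- by move=> Kx Ky g gG; rewrite rat_pullbackB ?Kx ?Ky // CSp_unit.
- by move=> Kx Ky g gG; rewrite rat_pullback_divf ?Kx ?Ky // CSp_unit.
Qed.

Lemma invariant_const c : @invariant_field R n m (@CSp R n) (constV R n m c).
Proof. by move=> g /CSp_unit gu; rewrite rat_pullback_const. Qed.

Lemma pullback_omega (g : 'M[R]_(n + n)) c (i j : 'I_m) :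
  g^T *m symplectic_mx R n *m g = c *: symplectic_mx R n ->
  poly_pullback g (omega (col i (generic_point R n m)) (col j (generic_point R n m))) =
  c%:MP * omega (col i (generic_point R n m)) (col j (generic_point R n m)).
Proof.
move=> gJ; apply: polyV_ext => A; rewrite meval_pullback mevalM mevalC.
have E (B : 'M[R]_(n + n, m)) :
    (omega (col i (generic_point R n m)) (col j (generic_point R n m))).@[mx_point B] =
    omega (col i B) (col j B).
  rewrite (rmorph_omega (meval (mx_point B))) !map_col.
  suff -> : map_mx (meval (mx_point B)) (generic_point R n m) = B by [].
  by apply/matrixP => k l; rewrite !mxE mevalXU /mx_point mxvecE.
rewrite !E -(omega_gsp _ _ gJ); congr (omega _ _).
  by rewrite colE -mulmxA -colE.
by rewrite colE -mulmxA -colE.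
Qed.

Lemma rat_pullback_ratio (g : 'M[R]_(n + n)) c (u v : polyV R n m) :
  g \in unitmx -> c != 0 -> v != 0 ->
  poly_pullback g u = c%:MP * u -> poly_pullback g v = c%:MP * v ->
  rat_pullback g (tofrac u / tofrac v) = tofrac u / tofrac v.
Proof.
move=> gu c0 v0 eu ev; rewrite rat_pullback_div // eu ev !tofracM.
rewrite -mulf_div divff ?mul1r //.
by rewrite tofrac_eq0 mpolyC_eq0.
Qed.

Lemma invariant_omega_div (i j i' j' : 'I_m) : omega_ij R n i' j' != 0 ->
  @invariant_field R n m (@CSp R n) (omega_ij R n i j / omega_ij R n i' j').
Proof.
move=> w0 g gG; have gu := CSp_unit gG; have [c c0 gJ] := CSp_gsp gG.
apply: (rat_pullback_ratio gu (lt0r_neq0 c0) _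
  (pullback_omega i j gJ) (pullback_omega i' j' gJ)).
by rewrite -tofrac_eq0.
Qed.

End InvariantField.

(** Labels of the transcendence basis. The ratio of the pair (0, 1) is the constant 1; ratios with
    both indices at least 2n lie in the field generated by the others. *)
Definition index_pairs (n m : nat) : {set 'I_m * 'I_m} :=
  finset (fun p : 'I_m * 'I_m => [&& (p.1 < p.2)%N, (p.1 < n.*2)%N
                          & ~~ ((p.1 == 0 :> nat) && (p.2 == 1 :> nat))]).

Lemma card_index_pairs (n m : nat) : (1 <= n)%N -> (2 <= m)%N ->
  #|index_pairs n m| = (dmn m n - 1)%N.
Proof.
move=> hn hm; pose i1 : 'I_m := Ordinal (ltnW hm); pose i2 : 'I_m := Ordinal hm.
pose T := finset (fun p : 'I_m * 'I_m => (p.1 < p.2)%N && (p.1 < n.*2)%N).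
have -> : index_pairs n m = (T :\ (i1, i2))%SET.
  apply/setP => -[i j]; rewrite !inE xpair_eqE -!val_eqE /=.
  by rewrite [RHS]andbC -andbA.
have Tc : #|T| = dmn m n.
  rewrite -sum1_card big_mkcond /=.
  rewrite (eq_bigr (fun p : 'I_m * 'I_m =>
    ((p.1 < p.2) && (p.1 < n.*2))%N : nat)); last first.
    by move=> p _; rewrite inE; case: ifP.
  rewrite -(pair_bigA _ (fun i j : 'I_m => ((i < j) && (i < n.*2))%N : nat)) /=.
  have cnt r i : (\sum_(j < r) (i < j) = r - i.+1)%N.
    by elim: r => [|r IH]; rewrite ?big_ord0 // big_ord_recr /= IH; lia.
  rewrite (eq_bigr (fun i : 'I_m => (i < n.*2) * (m - i.+1))%N); last first.
    move=> i _; rewrite -cnt big_distrr; apply: eq_bigr => j _ /=.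
    by case: (i < j)%N; case: (i < n.*2)%N.
  (* Row i < 2n contributes m - i - 1 pairs. The closed form of the partial sums is doubled and has
     its negative term moved to the left, to stay within natural numbers. *)
  have S r q : (r <= m)%N -> q = minn r n.*2 ->
     (2 * (\sum_(i < r) (i < n.*2) * (m - i.+1)) + q * q.+1 = 2 * q * m)%N.
    elim: r q => [|r IH] q rm qE; first by rewrite big_ord0 qE min0n.
    rewrite big_ord_recr /=; have := IH _ (ltnW rm) erefl; set s := (\sum_(_ < r) _)%N.
    case: (ltnP r n.*2) => h.
      have -> : q = r.+1 by lia.
      have -> : (m - r.+1 = m - r - 1)%N by lia.
      by nia.
    have -> : q = n.*2 by lia.
    by lia.
  have := S m _ (leqnn m) erefl; set s := (\sum_(_ < m) _)%N; rewrite /dmn.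
  case: ifP => h.
    have -> : minn m n.*2 = n.*2 by lia.
    by nia.
  have -> : minn m n.*2 = m by lia.
  rewrite bin2 => e; have -> : (m * m.-1 = s.*2)%N by nia.
  by rewrite doubleK.
have := cardsD1 (i1, i2) T; rewrite Tc inE /= double_gt0 hn => ->.
by rewrite add1n subn1.
Qed.

Definition mpoly_const (k : fieldType) (d : nat) :
  {rmorphism k -> {fraction {mpoly k[d]}}} :=
  (@tofrac {mpoly k[d]}) \o (@mpolyC d k).

(** A polynomial evaluated at the indeterminates is itself, so they satisfy no nontrivial
    relation. *)
Lemma mmap_generic (k : fieldType) (d : nat) (p : {mpoly k[d]}) :
  mmap (mpoly_const k d) (fun t => tofrac 'X_t) p = tofrac p.
Proof.
rewrite [in RHS](mpolyE p) rmorph_sum; apply: eq_bigr => a _.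
rewrite -mul_mpolyC rmorphM /=; congr (_ * _).
by rewrite mpolyXE_id rmorph_prod; apply: eq_bigr => i _; rewrite rmorphXn.
Qed.

Lemma std_gramN (F : fieldType) (i j : nat) : std_gram F i j = - std_gram F j i.
Proof. by rewrite /std_gram opprB. Qed.

Lemma omega_ij_alt (R : realType) (n m : nat) (i : 'I_m) :
  omega_ij R n i i = 0 :> ratV R n m.
Proof. by rewrite omega_ijE omega_alt. Qed.

Lemma omega_ijN (R : realType) (n m : nat) (i j : 'I_m) :
  omega_ij R n i j = - omega_ij R n j i :> ratV R n m.
Proof. by rewrite !omega_ijE omega_antisym. Qed.

Lemma ratio_in_subfield (R : realType) (n m : nat) (i1 i2 : 'I_m)
    (K : set (ratV R n m)) :
  subfield_closed K ->
  (forall i j : 'I_m, (i < j)%N -> (i < n.*2)%N ->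
    K (omega_ij R n i j / omega_ij R n i1 i2)) ->
  forall i j : 'I_m, (i < n.*2)%N || (j < n.*2)%N ->
  K (omega_ij R n i j / omega_ij R n i1 i2).
Proof.
move=> cK KI i j ij; case: (ltngtP i j) => h.
- by apply: KI => //; lia.
- by rewrite omega_ijN mulNr; apply/(subfieldN cK)/KI => //; lia.
- by rewrite (val_inj h) omega_ij_alt mul0r; exact: subfield0.
Qed.

(** * Algebraic independence of the ratios *)

Section Independence.
Variables (R : realType) (n m : nat).
Hypotheses (hn : (1 <= n)%N) (hm : (2 <= m)%N).
Local Notation i1 := (Ordinal (ltnW hm)).
Local Notation i2 := (Ordinal hm).
Local Notation d := #|index_pairs n m|.
Local Notation F := {fraction {mpoly R[d]}}.

Definition indep_ratio (t : 'I_d) : ratV R n m :=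
  omega_ij R n (enum_val t).1 (enum_val t).2 / omega_ij R n i1 i2.

Definition param_upper (i j : nat) : F :=
  if [pick t : 'I_d | ((enum_val t).1 == i :> nat) &&
                      ((enum_val t).2 == j :> nat)] is Some t
  then tofrac 'X_t else std_gram F i j.

(* Off [index_pairs] the entries are standard, so that the indeterminates
   specialize to the standard Gram matrix, whose pivots are 1. *)
Definition param_gram (i j : nat) : F :=
  if (i < j)%N then param_upper i j else if (j < i)%N then - param_upper j i else 0.

Lemma param_gram_alt : alternate param_gram.
Proof.
split=> [i|i j]; rewrite /param_gram ?ltnn //.
by case: ltngtP => _; rewrite ?opprK ?oppr0.
Qed.

Lemma regval_param_gram i j :
  regval idfun (fun t : 'I_d => std_gram R (enum_val t).1 (enum_val t).2)
    (param_gram i j) (std_gram R i j).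
Proof.
set x := fun t : 'I_d => _.
have rstd i' j' : regval idfun x (std_gram F i' j') (std_gram R i' j').
  by apply: regvalB; [case: (~~ _ && _) | case: (~~ _ && _)];
    (exact: regval1 || exact: regval0).
have rup i' j' : regval idfun x (param_upper i' j') (std_gram R i' j').
  rewrite /param_upper; case: pickP => [t /andP[/eqP <- /eqP <-]|_]; last exact: rstd.
  have := regval_tofrac idfun x 'X_t.
  by rewrite mmapX mmap1U.
rewrite /param_gram; case: ltngtP => [_|_|->]; first exact: rup.
  by rewrite std_gramN; apply/regvalN/rup.
have -> : std_gram R j j = 0 by rewrite /std_gram subrr.
exact: regval0.
Qed.

Lemma param_pivot k : (k < n)%N -> gram_pivot param_gram k != 0.
Proof.
apply: (gram_pivot_neq0 regval_param_gram) => r rn.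
by rewrite (@gram_red_std _ _ n) ?oner_eq0.
Qed.

Definition param_point : 'M[F]_(n + n, m) :=
  \matrix_(r, j) gram_vec param_gram n j r 0.

(** Gram-Schmidt realizes a Gram matrix up to the remainder [gram_red], which vanishes in the rows
    below 2n. *)
Lemma omega_param_point (i j : 'I_m) : (i < n.*2)%N ->
  omega (col i param_point) (col j param_point) = param_gram i j.
Proof.
move=> ni; have colE (l : 'I_m) : col l param_point = gram_vec param_gram n l.
  by apply/colP => r; rewrite mxE mxE.
rewrite !colE (omega_gram_vec param_pivot).
by rewrite (gram_red_eq0 param_pivot param_gram_alt) ?subr0.
Qed.

(** At [param_point] the ratio of index t takes the value X_t, so a relation p between the ratios
    becomes p = 0 in the field of fractions. *)
Lemma indep_ratio_independent : alg_independent (constV R n m) indep_ratio.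
Proof.
move=> p p0.
(* The pair (0, 1) is not in [index_pairs], so its entry is the standard value 1. *)
have o12 : omega (col i1 param_point) (col i2 param_point) = 1.
  rewrite omega_param_point /=; last by lia.
  rewrite /param_gram /param_upper; case: pickP => [t|_]; last by rewrite /std_gram /= subr0.
  by have := enum_valP t; rewrite inE => /and3P[_ _ /negP].
have rI t : regval (mpoly_const R d) (mx_point param_point) (indep_ratio t) (tofrac 'X_t).
  have /[!inE]/and3P[lt12 lt1n _] := enum_valP t.
  have -> : tofrac 'X_t = omega (col (enum_val t).1 param_point)
       (col (enum_val t).2 param_point) / omega (col i1 param_point) (col i2 param_point) :> F.
    rewrite o12 divr1 omega_param_point // /param_gram lt12 /param_upper.
    case: pickP => [u /andP[/eqP u1 /eqP u2]|/(_ t)]; last by rewrite !eqxx.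
    congr (tofrac 'X__); apply: enum_val_inj.
    by apply: injective_projections; apply: val_inj.
  by apply: regval_div; [exact: regval_omega_ij.. | rewrite o12 oner_eq0].
have rp : regval (mpoly_const R d) (mx_point param_point)
    (mmap (constV R n m) indep_ratio p) (mmap (mpoly_const R d) (fun t => tofrac 'X_t) p).
  exact: regval_mmap.
move: rp; rewrite p0 mmap_generic => /regval_uniq /(_ (regval0 _ _)) /eqP.
by rewrite tofrac_eq0 => /eqP.
Qed.

Lemma ratio_in_adjoin (i j : 'I_m) : (i < j)%N -> (i < n.*2)%N ->
  adjoin (constV R n m) (range indep_ratio) (omega_ij R n i j / omega_ij R n i1 i2).
Proof.
move=> ij ni; have cA := adjoin_subfield (constV R n m) (range indep_ratio).
case: (boolP ((i == 0 :> nat) && (j == 1 :> nat))) => h.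
  have [-> ->] : i = i1 /\ j = i2.
    by case/andP: h => /eqP i0 /eqP j1; split; apply: val_inj.
  by rewrite divff; [exact: subfield1 | exact: omega12_neq0].
have T : (i, j) \in index_pairs n m by rewrite inE /= ij ni.
have -> : omega_ij R n i j / omega_ij R n i1 i2 = indep_ratio (enum_rank_in T (i, j)).
  by rewrite /indep_ratio enum_rankK_in.
apply: adjoin_gen; exact: imageT.
Qed.

End Independence.

Theorem mainTheorem6 (R : realType) (n m : nat) (hn : (1 <= n)%N)
    (hm : (2 <= m)%N) :
  let i1 : 'I_m := Ordinal (ltnW hm) in
  let i2 : 'I_m := Ordinal hm in
  let I (i j : 'I_m) : ratV R n m := omega_ij R n i j / omega_ij R n i1 i2 in
  let gens := [set f | exists i j : 'I_m, (i < j)%N /\ f = I i j] in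
  let K := @invariant_field R n m (@CSp R n) in
  adjoin (constV R n m) gens = K /\
  has_trdeg (constV R n m) K (dmn m n - 1).
Proof.
move=> i1 i2 I gens K.
have KI i j : K (I i j) by apply: invariant_omega_div; exact: omega12_neq0.
(* Used twice: for all the generators, and for the independent ratios alone. *)
have KA (S : set (ratV R n m)) :
    (forall i j : 'I_m, (i < j)%N -> (i < n.*2)%N -> adjoin (constV R n m) S (I i j)) ->
    K `<=` adjoin (constV R n m) S.
  move=> SI f; have cA := adjoin_subfield (constV R n m) S.
  have cc c : adjoin (constV R n m) S (constV R n m c) by exact: adjoin_const.
  exact: (invariant_in_subfield hn cA cc (ratio_in_subfield cA SI)).
split.
  apply/seteqP; split; last first.
    by apply: (KA gens) => i j ij _; apply: adjoin_gen; exists i, j.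
  move=> f /(_ K); apply; split; first exact: invariant_subfield.
  move=> {f} f [[c _ <-]|[i [j [_ ->]]]]; [exact: invariant_const | exact: KI].
rewrite -card_index_pairs //; exists (indep_ratio R hm); split=> [t||x Kx].
- exact: KI.
- exact: indep_ratio_independent.
(* The independent ratios already generate K, so an invariant x is a root of X - x over their
   field. *)
- apply: algebraic_mem; first exact: adjoin_subfield.
  by apply: (KA _ _ _ Kx) => i j; exact: ratio_in_adjoin.
Qed.
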